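(* Let $(R,\mathfrak{m},k)$ be a noetherian local domain of prime characteristic $p$ and let $G$ be a finite cyclic group of order $p^{r}h$, with $r>0$, acting wildly on $R$. (i) If $R$ satisfies Serre's condition $S(2)$, then $R^G$ satisfies $S(2)$. (ii) Suppose $\mathrm{depth}(R)>1$ and $\dim R>2$. Then $R^G$ does not satisfy $S(n)$ for any $n>2$.
   Context: $G$ acts wildly on $R$ if: (i) $G$ acts trivially on the residue field $k$; (ii) $G$ acts freely on the punctured spectrum $\mathrm{Spec}(R)\setminus\{\mathfrak{m}\}$, i.e. for every prime $P\neq\mathfrak{m}$ the inertia group $\{g\in G: g(a)-a\in P\text{ for all }a\in R\}$ is trivial (so that $R^G\to R$ is étale away from the closed point); (iii) $R^G$ is noetherian and $R$ is a finite $R^G$-module. A noetherian ring $A$ satisfies Serre's condition $S(m)$ if $\mathrm{depth}(A_{\mathfrak{p}})\geq\min\{m,\dim A_{\mathfrak{p}}\}$ for all $\mathfrak{p}\in\mathrm{Spec}(A)$. *)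

(* Defs.v *)
From HB Require Import structures.
From mathcomp Require Import all_boot all_order all_fingroup all_algebra all_solvable.
From mathcomp Require Import boolp classical_sets constructive_ereal.
Set Implicit Arguments.
Unset Strict Implicit.
Unset Printing Implicit Defensive.
Import Order.TTheory GRing.Theory Num.Theory.
Local Open Scope ring_scope.

(* MathComp's [idealr A] and [prime_idealr A] are bundled boolean predicates,
   and an [idealr A] is always a *proper* ideal. *)

Definition maximal_ideal (A : comNzRingType) (M : idealr A) : Prop :=
  forall J : idealr A, {subset M <= J} -> J =i M.

Definition local_ring (A : comNzRingType) (M : idealr A) : Prop :=
  maximal_ideal M /\ forall N : idealr A, maximal_ideal N -> N =i M.

Definition ideal_gen (A : comNzRingType) (s : seq A) : set A :=
  fun x => exists c : nat -> A, x = \sum_(i < size s) c i * s`_i.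

(* The unit ideal, which is not an [idealr A], is always generated by 1. *)
Definition noetherian (A : comNzRingType) : Prop :=
  forall I : idealr A, exists s : seq A, forall x, x \in I <-> ideal_gen s x.

(* Dimensions and depths are suprema of sets of naturals, taken in the
   extended integers: unbounded sets have supremum +oo. *)
Definition sup_nat (S : set nat) : \bar int :=
  supremum -oo%E [set (n%:Z)%:E | n in S]%classic.

Definition prime_chain (A : comNzRingType) (n : nat)
    (P : nat -> prime_idealr A) : Prop :=
  forall i, (i < n)%N ->
    {subset P i <= P i.+1} /\ ~ {subset P i.+1 <= P i}.

Definition krull_dim (A : comNzRingType) : \bar int :=
  sup_nat (fun n => exists P : nat -> prime_idealr A, prime_chain n P).

Definition regular_sequence (A : comNzRingType) (s : seq A) : Prop :=
  (forall (i : nat) (a : A), (i < size s)%N ->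
     ideal_gen (take i s) (s`_i * a) -> ideal_gen (take i s) a)
  /\ ~ ideal_gen s 1.

(* For a noetherian local ring with maximal ideal M, this is its depth. *)
Definition depth (A : comNzRingType) (M : idealr A) : \bar int :=
  sup_nat (fun n => exists s : seq A,
    [/\ size s = n, {subset s <= M} & regular_sequence s]).

Section Localization.
Variables (A : idomainType) (P : prime_idealr A).

(* The localization of a domain, as a subring of its field of fractions. *)
Definition in_localization : {pred {fraction A}} := fun x =>
  `[< exists a s : A, s \notin P /\ x = tofrac a / tofrac s >].

Lemma notin_prime_neq0 (s : A) : s \notin P -> tofrac s != 0.
Proof. by rewrite tofrac_eq0; apply: contraNneq => ->; rewrite rpred0. Qed.

Lemma notin_primeM (s t : A) : s \notin P -> t \notin P -> s * t \notin P.
Proof. by rewrite prime_idealrM negb_or => -> ->. Qed.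

Lemma in_localization_subring : subring_closed in_localization.
Proof.
split.
- apply/asboolP; exists 1, 1; split; first by rewrite idealr1.
  by rewrite tofrac1 divr1.
- move=> x y /asboolP[a [s [sP ->]]] /asboolP[b [t [tP ->]]].
  apply/asboolP; exists (a * t - b * s), (s * t).
  split; first exact: notin_primeM.
  rewrite tofracB !tofracM -mulNr addf_div ?notin_prime_neq0 //.
  by rewrite mulNr.
- move=> x y /asboolP[a [s [sP ->]]] /asboolP[b [t [tP ->]]].
  apply/asboolP; exists (a * b), (s * t); split; first exact: notin_primeM.
  by rewrite !tofracM mulf_div.
Qed.

HB.instance Definition _ :=
  GRing.isSubringClosed.Build {fraction A} in_localization
    in_localization_subring.

Record localization := Localization {
  localization_val :> {fraction A};
  _ : localization_val \in in_localization }.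

HB.instance Definition _ := [isSub for localization_val].
HB.instance Definition _ := [Choice of localization by <:].
HB.instance Definition _ :=
  [SubChoice_isSubComNzRing of localization by <:].

(* The ideal P A_P. *)
Definition localization_max : {pred localization} := fun x =>
  `[< exists a s : A,
        [/\ a \in P, s \notin P & val x = tofrac a / tofrac s] >].

Lemma localization_max_idealr : idealr_closed localization_max.
Proof.
split.
- apply/asboolP; exists 0, 1; split; rewrite ?rpred0 ?idealr1 //.
  by rewrite tofrac0 mul0r rmorph0.
- apply/asboolP => -[a [s [aP sP]]]; rewrite rmorph1 => /esym/divr1_eq/eqP.
  by rewrite tofrac_eq => /eqP eas; rewrite -eas aP in sP.
- move=> x u v /asboolP[a [s [aP sP Eu]]] /asboolP[b [t [bP tP Ev]]].
  have /asboolP[c [w [wP Ex]]] := valP x.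
  apply/asboolP; exists (c * a * t + b * (w * s)), (w * s * t).
  split; rewrite ?notin_primeM //.
    by rewrite rpredD // mulrC ?idealMr.
  rewrite rmorphD rmorphM /= Eu Ev [\val x]Ex !(tofracD, tofracM).
  by rewrite mulf_div addf_div // ?mulf_neq0 // ?notin_prime_neq0.
Qed.

HB.instance Definition _ :=
  isIdealr.Build localization localization_max localization_max_idealr.

End Localization.

Arguments localization_max {A} P.

Definition serre (n : nat) (A : idomainType) : Prop :=
  forall P : prime_idealr A,
    (Order.min (n%:Z)%:E (krull_dim (localization P))
       <= depth (localization_max P))%E.

(* Together these conditions make every [act g] a ring automorphism. *)
Definition ring_action (G : finGroupType) (R : idomainType)
    (act : G -> {rmorphism R -> R}) : Prop :=
  act 1%g =1 id /\ forall g h : G, act (g * h)%g =1 act g \o act h.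

Section Invariants.
Variables (G : finGroupType) (R : idomainType) (act : G -> {rmorphism R -> R}).

Definition is_invariant : {pred R} := fun x => [forall g, act g x == x].

Lemma is_invariant_divring : divring_closed is_invariant.
Proof.
split.
- by apply/forallP => g; rewrite rmorph1.
- move=> x y /forallP Hx /forallP Hy; apply/forallP => g.
  by rewrite rmorphB (eqP (Hx g)) (eqP (Hy g)).
- move=> x y /forallP Hx /forallP Hy; apply/forallP => g.
  rewrite rmorphM (eqP (Hx g)); case: (boolP (y \is a GRing.unit)) => yU.
    by rewrite rmorphV // (eqP (Hy g)).
  by rewrite (invr_out yU) (eqP (Hy g)).
Qed.

HB.instance Definition _ :=
  GRing.isDivringClosed.Build R is_invariant is_invariant_divring.

Record invariants := Invariant {
  invariant_val :> R;
  _ : invariant_val \in is_invariant }.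

HB.instance Definition _ := [isSub for invariant_val].
HB.instance Definition _ := [Choice of invariants by <:].
HB.instance Definition _ :=
  [SubChoice_isSubIntegralDomain of invariants by <:].

Definition inertia (P : prime_idealr R) : set G :=
  fun g => forall a : R, act g a - a \in P.

Definition finite_over_invariants : Prop :=
  exists s : seq R, forall x : R, exists c : nat -> invariants,
    x = \sum_(i < size s) val (c i) * s`_i.

Definition acts_wildly (M : idealr R) : Prop :=
  [/\ forall (g : G) (a : R), (act g a = a %[ mod_ideal M])%qT,
      forall P : prime_idealr R, ~ (P =i M) ->
        forall g : G, inertia P g -> g = 1%g,
      noetherian invariants
    & finite_over_invariants].

End Invariants.

(* Main.v *)
From HB Require Import structures.
Require Import Defs.
From mathcomp Require Import all_boot all_order all_fingroup all_algebra all_solvable.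
From mathcomp Require Import ring.
From mathcomp Require Import boolp classical_sets constructive_ereal.
Set Implicit Arguments.
Unset Strict Implicit.
Unset Printing Implicit Defensive.
Import Order.TTheory GRing.Theory Num.Theory.
Local Open Scope ring_scope.

(* Write A = R^G.  (i) If S(2) fails at a prime q of A of height at least 2,
   there are a in q and x in A_q \ a A_q with q x contained in a A_q.  Over a
   prime P of R above q the fraction x / a is multiplied into R_P by a
   P-primary ideal, hence lies in R_P as depth R_P >= 2.  But the ideal of
   denominators of x / a is G-stable and contracts into q, which forces it into
   P: a contradiction.
   (ii) Let sigma generate G.  As |G| = 0 in R, the class of 1 in
   H^1(G, R) = ker Tr / im (sigma - 1) makes sense; it is not zero, since G acts
   trivially on the residue field, and the ideal Tr(R), which is primary to the
   maximal ideal since the action is free elsewhere, kills it.  As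
   depth R >= 2, this is a nonzero class in the second local cohomology of A, so
   depth A <= 2, whereas dim A = dim R > 2. *)

(** * Ideals of noetherian rings *)

Section Ideals.
Variable A : comNzRingType.
Implicit Types (I J N : A -> Prop) (s : seq A).

(* Unlike an [idealr], an [ideal] is a mere predicate and may be the unit
   ideal. *)
Definition ideal I : Prop :=
  [/\ I 0, forall x y, I x -> I y -> I (x + y) & forall a x, I x -> I (a * x)].

Definition prime_ideal I : Prop :=
  [/\ ideal I, ~ I 1 & forall x y, I (x * y) -> I x \/ I y].

Definition colon I (x : A) : A -> Prop := fun a => I (a * x).

Lemma idealB I x y : ideal I -> I x -> I y -> I (x - y).
Proof. by move=> [_ ID IM] Ix Iy; apply: ID => //; rewrite -mulN1r; apply: IM. Qed.

Lemma ideal_mull I x y : ideal I -> I x -> I (x * y).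
Proof. by move=> [_ _ IM] Ix; rewrite mulrC; apply: IM. Qed.

Lemma ideal_sum I (T : Type) (r : seq T) (P : pred T) (F : T -> A) :
  ideal I -> (forall i, P i -> I (F i)) -> I (\sum_(i <- r | P i) F i).
Proof. by move=> [I0 ID _] IF; elim/big_ind: _. Qed.

Lemma idealr_ideal (J : idealr A) : ideal (fun x => x \in J).
Proof.
split; first exact: rpred0.
  by move=> x y; apply: rpredD.
by move=> a x; apply: idealMr.
Qed.

Lemma ideal_idealr_closed I : ideal I -> ~ I 1 ->
  idealr_closed (fun x : A => `[< I x >]).
Proof.
move=> [I0 ID IM] I1; split; first by rewrite unfold_in; apply/asboolP.
  by rewrite unfold_in; apply/asboolP.
move=> a x y; rewrite !unfold_in => /asboolP Ix /asboolP Iy.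
by apply/asboolP/ID => //; apply: IM.
Qed.

Lemma idealr_of I : ideal I -> ~ I 1 ->
  exists J : idealr A, forall x, x \in J <-> I x.
Proof.
move=> iI I1.
pose S : A -> bool := fun x => `[< I x >].
pose mx := isIdealr.Build A S (ideal_idealr_closed iI I1).
pose J : idealr A := HB.pack S mx.
by exists J => x; rewrite unfold_in; split => /asboolP.
Qed.

Lemma prime_idealr_of I : prime_ideal I ->
  exists P : prime_idealr A, forall x, x \in P <-> I x.
Proof.
move=> [iI I1 Ip].
pose S : A -> bool := fun x => `[< I x >].
pose mx := isIdealr.Build A S (ideal_idealr_closed iI I1).
have Sp : prime_idealr_closed S.
  move=> x y; rewrite !unfold_in => /asboolP/Ip[] H; apply/orP;
  by [left; apply/asboolP|right; apply/asboolP].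
pose mp := isPrimeIdealrClosed.Build A S Sp.
pose P : prime_idealr A := HB.pack S mx mp.
by exists P => x; rewrite unfold_in; split => /asboolP.
Qed.

Lemma ideal_gen_ideal s : ideal (ideal_gen s).
Proof.
split.
- by exists (fun=> 0); rewrite big1 // => i _; rewrite mul0r.
- move=> x y [c ->] [d ->]; exists (fun i => c i + d i).
  by rewrite -big_split; apply: eq_bigr => i _; rewrite mulrDl.
- move=> a x [c ->]; exists (fun i => a * c i).
  by rewrite mulr_sumr; apply: eq_bigr => i _; rewrite mulrA.
Qed.

Lemma ideal_gen_mem s x : x \in s -> ideal_gen s x.
Proof.
move=> xs; have xi : (index x s < size s)%N by rewrite index_mem.
exists (fun i => (i == index x s)%:R).
rewrite (bigD1 (Ordinal xi)) //= eqxx mul1r nth_index // big1 ?addr0 //.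
by move=> i; rewrite -val_eqE /= => /negPf ->; rewrite mul0r.
Qed.

Lemma ideal_gen_sub I s x : ideal I -> {in s, forall y, I y} ->
  ideal_gen s x -> I x.
Proof.
move=> iI Is [c ->]; apply: ideal_sum => // i _.
by have [_ _ IM] := iI; apply/IM/Is/mem_nth.
Qed.

Lemma colon_ideal I x : ideal I -> ideal (colon I x).
Proof.
move=> [I0 ID IM]; rewrite /colon; split; first by rewrite mul0r.
  by move=> a b Ia Ib; rewrite mulrDl; apply: ID.
by move=> a b Ib; rewrite -mulrA; apply: IM.
Qed.

Definition adjoin I s : A -> Prop :=
  fun x => exists y z, [/\ I y, ideal_gen s z & x = y + z].

Lemma adjoin_ideal I s : ideal I -> ideal (adjoin I s).
Proof.
move=> [I0 ID IM]; have [G0 GD GM] := ideal_gen_ideal s; split.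
- by exists 0, 0; rewrite addr0.
- move=> _ _ [y [z [Iy Gz ->]]] [y' [z' [Iy' Gz' ->]]].
  by exists (y + y'), (z + z'); rewrite addrACA; split; [apply: ID|apply: GD|].
- move=> a _ [y [z [Iy Gz ->]]]; exists (a * y), (a * z).
  by rewrite mulrDr; split; [apply: IM|apply: GM|].
Qed.

Lemma adjoinl I s x : I x -> adjoin I s x.
Proof. by exists x, 0; rewrite addr0; split => //; case: (ideal_gen_ideal s). Qed.

Lemma adjoin_sub I J s x : ideal J -> (forall y, I y -> J y) ->
  {in s, forall y, J y} -> adjoin I s x -> J x.
Proof.
move=> iJ IJ sJ [y [z [/IJ Jy Gz ->]]]; have [_ JD _] := iJ.
by apply: JD => //; apply: ideal_gen_sub Gz.
Qed.

Lemma adjoin_mem I s x : ideal I -> x \in s -> adjoin I s x.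
Proof.
by move=> [I0 _ _] xs; exists 0, x; rewrite add0r; split => //; apply: ideal_gen_mem.
Qed.

Hypothesis A_noetherian : noetherian A.

Lemma noetherian_fg I : ideal I ->
  exists s, forall x, I x <-> ideal_gen s x.
Proof.
move=> iI; have [I1|I1] := pselect (I 1).
  exists [:: 1] => x; have [_ _ IM] := iI; split=> _.
    have [_ _ GM] := ideal_gen_ideal [:: 1 : A].
    by rewrite -[x]mulr1; apply/GM/ideal_gen_mem; rewrite inE.
  by rewrite -[x]mulr1; apply: IM.
have [J EJ] := idealr_of iI I1; have [s Es] := A_noetherian J.
by exists s => x; rewrite -EJ.
Qed.

(** Otherwise choice builds a strictly ascending chain in [F]; its union is finitely generated, and
    the generators already lie in one term. *)
Lemma noetherian_maximal (F : (A -> Prop) -> Prop) :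
  (forall I, F I -> ideal I) -> (exists I, F I) ->
  exists I, F I /\ forall J, F J -> (forall x, I x -> J x) ->
    forall x, J x -> I x.
Proof.
move=> Fi [I0 FI0]; apply: contrapT => noMax.
have step (I : {I | F I}) : exists J : {I | F I},
    (forall x, sval I x -> sval J x) /\ ~ (forall x, sval J x -> sval I x).
  apply: contrapT => noJ; apply: noMax; exists (sval I).
  split=> [|J FJ IJ]; first exact: svalP.
  by apply: contrapT => JI; apply: noJ; exists (exist _ J FJ).
have {step} [f fP] := choice step.
pose I n := sval (iter n f (exist _ I0 FI0)).
have iI n : ideal (I n) by apply/Fi/svalP.
have leI m n x : (m <= n)%N -> I m x -> I n x.
  by move/subnK <-; elim: (n - m)%N => //= k IH /IH; apply: (fP _).1.
have iU : ideal (fun x => exists n, I n x).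
  split; first by exists 0%N; case: (iI 0%N).
    move=> x y [m Imx] [n Iny]; exists (maxn m n).
    have [_ ID _] := iI (maxn m n).
    by apply: ID; [apply: leI Imx; rewrite leq_maxl|apply: leI Iny; rewrite leq_maxr].
  by move=> a x [n Inx]; exists n; have [_ _ IM] := iI n; apply: IM.
have [s sP] := noetherian_fg iU.
have [n sn] : exists n, {in s, forall y, I n y}.
  have : {in s, forall y, exists n, I n y} by move=> y /ideal_gen_mem/sP.
  elim: s {sP} => [_|y s IH sU]; first by exists 0%N.
  have [|n sn] := IH; first by move=> z zs; apply: sU; rewrite inE zs orbT.
  have [|m ym] := sU y; first by rewrite inE eqxx.
  exists (maxn m n) => z; rewrite inE => /predU1P[->|zs].
    by apply: leI ym; rewrite leq_maxl.
  by apply: leI (sn z zs); rewrite leq_maxr.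
apply: (fP (iter n f (exist _ I0 FI0))).2 => x Jx.
apply: (ideal_gen_sub (iI n) sn); apply/sP; exists n.+1; exact: Jx.
Qed.

(* The last clause is the maximality of P among the ideals disjoint from S. *)
Lemma exists_prime_disjoint I (S : A -> Prop) : ideal I ->
  S 1 -> (forall x y, S x -> S y -> S (x * y)) ->
  (forall x, I x -> ~ S x) ->
  exists P : prime_idealr A, [/\ forall x, I x -> x \in P,
    forall x, x \in P -> ~ S x
    & forall x, x \notin P -> exists y r, y \in P /\ S (y + r * x)].
Proof.
move=> iI S1 SM IS.
have [||P [[iP IP PS] Pmax]] := @noetherian_maximal
  (fun J => [/\ ideal J, forall x, I x -> J x & forall x, J x -> ~ S x]).
- by move=> J [].
- by exists I.
have meetS x : ~ P x -> exists y r, P y /\ S (y + r * x).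
  move=> Px; apply: contrapT => noS; apply: Px.
  apply: (Pmax (adjoin P [:: x])); last by apply: adjoin_mem; rewrite ?inE.
    split; [exact: adjoin_ideal| by move=> y /IP; apply: adjoinl|].
    move=> _ [y [z [Py [c ->] ->]]]; rewrite big_ord_recl big_ord0 /= addr0 => Sy.
    by apply: noS; exists y, (c 0%N).
  by move=> y; apply: adjoinl.
have pP : prime_ideal P.
  split=> //; first by move/PS; apply.
  (* Modulo P the product of u + r x and v + t y, both in S, is a multiple of x y. *)
  move=> x y Pxy; apply: contrapT => /not_orP[/meetS[u [r [Pu Su]]]].
  move=> /meetS[v [t [Pv Sv]]]; apply: (PS _ _ (SM _ _ Su Sv)).
  have [_ PD PM] := iP.
  rewrite mulrDr; apply: (PD); first exact: PM.
  rewrite mulrDl; apply: (PD); first exact: ideal_mull.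
  by rewrite mulrACA; apply: PM.
have [Q QP] := prime_idealr_of pP.
exists Q; split; first by move=> x /IP/QP.
  by move=> x /QP/PS.
move=> x /negP xQ; have [|y [r [Py Sy]]] := meetS x; first by move/QP.
by exists y, r; split=> //; apply/QP.
Qed.

(** The multiplicative set is the set of powers of x. The contrapositive is how an ideal is shown to
    contain a power of x. *)
Lemma exists_prime_avoiding_powers I x : ideal I ->
  (forall n, ~ I (x ^+ n)) ->
  exists P : prime_idealr A, (forall y, I y -> y \in P) /\ x \notin P.
Proof.
move=> iI Ix.
have [|||P [IP PS _]] := @exists_prime_disjoint I (fun y => exists n, y = x ^+ n) iI.
- by exists 0%N; rewrite expr0.
- by move=> _ _ [m ->] [n ->]; exists (m + n)%N; rewrite exprD.
- by move=> y Iy [n Ey]; apply: (Ix n); rewrite -Ey.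
by exists P; split=> //; apply/negP => /PS; apply; exists 1%N; rewrite expr1.
Qed.

End Ideals.

(** Induction on the list: an x of I avoiding the primes not contained in Q t is corrected, when it
    lies in Q t, by an element y of I that is outside Q t but in all those other primes. *)
Lemma prime_avoidance (A : comNzRingType) (I : A -> Prop) (T : eqType)
    (Q : T -> A -> Prop) (s : seq T) :
  ideal I -> {in s, forall t, prime_ideal (Q t)} ->
  (forall x, I x -> exists2 t, t \in s & Q t x) ->
  exists2 t, t \in s & forall x, I x -> Q t x.
Proof.
move=> iI pQ cov; apply: contrapT => nosub.
have {}nosub t : t \in s -> exists2 x, I x & ~ Q t x.
  move=> ts; apply: contrapT => H; apply: nosub; exists t => // x Ix.
  by apply: contrapT => Qx; apply: H; exists x.
suff [x Ix xs] : exists2 x, I x & {in s, forall t, ~ Q t x}.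
  by have [t ts] := cov x Ix; apply: xs.
have [n] := ubnP (size s); elim: n s nosub pQ {cov} => // n IH [|t s] nosub pQ /=.
  by move=> _; exists 0 => //; case: iI.
rewrite ltnS => sn.
pose below t' := `[< forall x, Q t' x -> Q t x >].
have [|||x Ix xs] := IH [seq t' <- s | ~~ below t'].
- by move=> t'; rewrite mem_filter => /andP[_ t's]; apply: nosub; rewrite inE t's orbT.
- by move=> t'; rewrite mem_filter => /andP[_ t's]; apply: pQ; rewrite inE t's orbT.
- by rewrite (leq_ltn_trans _ sn) // size_filter count_size.
suff [y Iy [yt ys]] : exists2 y, I y &
    ~ Q t y /\ {in [seq t' <- s | ~~ below t'], forall t', ~ Q t' y}.
  exists y => // t'; rewrite inE => /predU1P[-> //|t's].
  have [/asboolP le|nle] := boolP (below t'); first by move/le.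
  by apply: ys; rewrite mem_filter nle.
have [Qx|] := pselect (Q t x); last by exists x.
have [|y0 Iy0 Qy0] := nosub t; first by rewrite inE eqxx.
have [iQ Q1 Qp] := pQ t (mem_head _ _).
(* Multiply [y0] by an element of Q t' outside Q t for each remaining t'; primality of Q t keeps the
   product outside. *)
have [y [Iy Qy ys]] : exists y, [/\ I y, ~ Q t y &
    {in [seq t' <- s | ~~ below t'], forall t', Q t' y}].
  have {}pQ t' : t' \in s -> prime_ideal (Q t').
    by move=> t's; apply: pQ; rewrite inE t's orbT.
  elim: s pQ {nosub sn xs} => [_|t' s IHs pQ] /=; first by exists y0.
  have [|y [Iy Qy ys]] := IHs.
    by move=> t'' t''s; apply: pQ; rewrite inE t''s orbT.
  have [le|/asboolP nle] := boolP (below t'); first by exists y.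
  have [z [Q'z Qz]] : exists z, Q t' z /\ ~ Q t z.
    apply: contrapT => H; apply: nle => z Q'z.
    by apply: contrapT => Qz; apply: H; exists z.
  exists (z * y); split; first by have [_ _ IM] := iI; apply: IM.
    by move=> /Qp[].
  move=> t''; rewrite inE => /predU1P[->|t''s].
    by apply: ideal_mull => //; case: (pQ t' (mem_head _ _)).
  have [[_ _ IM] _ _] : prime_ideal (Q t'').
    by apply: pQ; move: t''s; rewrite mem_filter inE => /andP[_ ->]; rewrite orbT.
  exact/IM/ys.
exists (x + y); first by have [_ ID _] := iI; apply: ID.
split=> [Qxy|t' t's Q'xy].
  by apply: Qy; rewrite -[y](addKr x) addrC; apply: idealB.
have [|iQ' _ _] := pQ t'.
  by move: t's; rewrite mem_filter inE => /andP[_ ->]; rewrite orbT.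
apply: (xs t') => //.
by rewrite -[x](addrK y); apply: idealB => //; apply: ys.
Qed.

(* The maximal annihilators (N : x) are prime, and finitely many by
   noetherianity, so prime avoidance puts I inside one of them. *)
Lemma noetherian_zero_divisors (A : comNzRingType) (I N : A -> Prop) :
  noetherian A -> ideal I -> ideal N -> ~ N 1 ->
  (forall b, I b -> exists2 x, ~ N x & N (b * x)) ->
  exists2 x, ~ N x & forall b, I b -> N (b * x).
Proof.
move=> hA iI iN N1 zd; have [N0 ND NM] := iN.
pose maxann x := ~ N x /\ forall y, ~ N y ->
  (forall a, N (a * x) -> N (a * y)) -> forall a, N (a * y) -> N (a * x).
have prime_ann x : maxann x -> prime_ideal (colon N x).
  move=> [Nx xmax]; split; first exact: colon_ideal.
    by rewrite /colon mul1r.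
  move=> a b; rewrite /colon => Nabx.
  have [Nbx|Nbx] := pselect (N (b * x)); [by right|left].
  by apply: (xmax (b * x)) => // [c Ncx|]; rewrite ?mulrA // -mulrA mulrCA; apply: NM.
have below_max y : ~ N y ->
    exists2 x, maxann x & forall a, N (a * y) -> N (a * x).
  move=> Ny.
  have [|| K [[[x Nx EK] yK] Kmax]] := @noetherian_maximal A hA
    (fun K => (exists2 x, ~ N x & K = colon N x) /\ forall a, N (a * y) -> K a).
  - by move=> K [[x _ ->] _]; apply: colon_ideal.
  - by exists (colon N y); split=> //; exists y.
  rewrite {K}EK in yK Kmax; exists x => //; split=> // z Nz xz a.
  by apply: (Kmax (colon N z)) => //; split=> [|b /yK/xz //]; exists z.
(* Take [xs] with N + (xs) maximal; it then contains every x with a maximal annihilator. *)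
have [||K [[xs xsmax EK] Kmax]] := @noetherian_maximal A hA
  (fun K => exists2 xs, {in xs, forall x, maxann x} & K = adjoin N xs).
- by move=> K [xs _ ->]; apply: adjoin_ideal.
- by exists (adjoin N [::]), [::].
rewrite {K}EK in Kmax.
have in_xs x : maxann x -> adjoin N xs x.
  move=> xmax; apply: (Kmax (adjoin N (x :: xs))).
  - by exists (x :: xs) => // z; rewrite inE => /predU1P[->|/xsmax].
  - move=> z; apply: adjoin_sub; first exact: adjoin_ideal.
      by move=> u; apply: adjoinl.
    by move=> u us; apply: adjoin_mem => //; rewrite inE us orbT.
  - by apply: adjoin_mem => //; rewrite inE eqxx.
(* Otherwise each t in [xs] has a multiplier killing t but not x modulo N; as the annihilator of x
   is prime, their product a kills [xs] but not x, although x lies in N + (xs). *)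
have max_in x : maxann x ->
    exists2 t, t \in xs & forall a, N (a * x) -> N (a * t).
  move=> xmax; apply: contrapT => H.
  have [a [aN ax]] : exists a, {in xs, forall t, N (a * t)} /\ ~ N (a * x).
    have [_ _ xp] := prime_ann x xmax.
    elim: xs xsmax H {Kmax in_xs} => [_ _|t xs IH tmax H].
      by exists 1; split=> //; rewrite mul1r; case: xmax.
    have [||a [aN ax]] := IH.
    - by move=> u us; apply: tmax; rewrite inE us orbT.
    - by move=> [u us xu]; apply: H; exists u => //; rewrite inE us orbT.
    have [b Nbt Nbx] : exists2 b, N (b * t) & ~ N (b * x).
      apply: contrapT => H'; apply: H; exists t; first exact: mem_head.
      have [Nt] := tmax t (mem_head _ _); apply; first by case: xmax.
      by move=> b Nbt; apply: contrapT => Nbx; apply: H'; exists b.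
    exists (a * b); split=> [u|/xp[]//].
    rewrite inE => /predU1P[->|/aN Nau]; first by rewrite -mulrA; apply: NM.
    by rewrite mulrAC mulrC; apply: NM.
  apply: ax; rewrite mulrC; apply: (adjoin_sub (J := colon N a)) (in_xs x xmax).
  - exact: colon_ideal.
  - by move=> y Ny; apply: ideal_mull.
  - by move=> t /aN; rewrite /colon mulrC.
have [||t ts It] := @prime_avoidance A I A (colon N) xs iI.
- by move=> t /xsmax/prime_ann.
- move=> b /zd[y Ny Nby]; have [x xmax yx] := below_max y Ny.
  by have [t ts xt] := max_in x xmax; exists t => //; apply/xt/yx.
by exists t => //; case: (xsmax t ts).
Qed.

(** * Regular sequences of length two *)

Section RegularPair.
Variables (B : comNzRingType) (u v : B).
Hypothesis u_reg : forall x, u * x = 0 -> x = 0.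
Hypothesis v_reg : forall x w, v * x = u * w -> exists y, x = u * y.

Lemma regular_pow m x : u ^+ m * x = 0 -> x = 0.
Proof. by elim: m x => [|m IH] x; rewrite ?mul1r // exprS -mulrA => /u_reg/IH. Qed.

Lemma regular_pair_pow m n x w :
  v ^+ m * x = u ^+ n * w -> exists y, x = u ^+ n * y.
Proof.
(* If v x = u^(k+1) w, then x = u x', and cancelling u leaves v x' = u^k w. *)
have v1 : forall n x w, v * x = u ^+ n * w -> exists y, x = u ^+ n * y.
  elim=> [|k IH] {}x {}w; first by move=> _; exists x; rewrite mul1r.
  rewrite exprS -mulrA => E; have [x' Ex] := v_reg E.
  have [|y Ey] := IH x' w; last by exists y; rewrite Ex Ey mulrA.
  apply/subr0_eq/u_reg; apply/eqP.
  by rewrite mulrBr subr_eq0 -E Ex mulrCA.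
elim: m x w => [|m IH] x w; first by rewrite mul1r; exists w.
by rewrite exprSr -mulrA => /IH[w' /v1].
Qed.

(* If the fraction n / a becomes integral after multiplication by powers of u
   and of v, it is integral. *)
Lemma regular_pair_integral a n e e' k m :
  (forall x, a * x = 0 -> x = 0) ->
  u ^+ k * n = a * e -> v ^+ m * n = a * e' -> exists z, n = a * z.
Proof.
move=> a_reg En En'.
(* Cancelling a in a v^m e = u^k v^m n = a u^k e' gives v^m e = u^k e', so u^k divides e. *)
have [|z Ez] := @regular_pair_pow m k e e'.
  apply/subr0_eq/a_reg.
  by rewrite mulrBr mulrCA -En [a * (_ * _)]mulrCA -En' mulrCA subrr.
exists z; apply/subr0_eq/(@regular_pow k).
by rewrite mulrBr En Ez mulrCA subrr.
Qed.

End RegularPair.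

(** * The ring of invariants *)

Lemma prime_idealrX (A : comNzRingType) (P : prime_idealr A) x n :
  x ^+ n \in P -> x \in P.
Proof.
elim: n => [|n IH]; first by rewrite idealr1.
by rewrite exprS prime_idealrM => /orP[].
Qed.

Section InvariantRing.
Variables (G : finGroupType) (R : idomainType) (act : G -> {rmorphism R -> R}).
Hypothesis act_action : ring_action act.
Local Notation A := (invariants act).

Lemma act_invariant (g : G) (a : A) : act g (val a) = val a.
Proof. by have /forallP/(_ g)/eqP := valP a. Qed.

Lemma invariant_of x : (forall g, act g x = x) -> exists a : A, val a = x.
Proof.
move=> gx; have xinv : x \in is_invariant act by apply/forallP => g; rewrite gx.
by exists (Invariant xinv).
Qed.

Lemma invariant_eq0 (a : A) : (val a == 0) = (a == 0).
Proof. by rewrite -(inj_eq val_inj) rmorph0. Qed.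

Lemma val_invariantM (a b : A) : val (a * b) = val a * val b.
Proof. by rewrite rmorphM. Qed.

Lemma val_invariantD (a b : A) : val (a + b) = val a + val b.
Proof. by rewrite rmorphD. Qed.

Lemma val_invariantN (a : A) : val (- a) = - val a.
Proof. by rewrite rmorphN. Qed.

(** For a nonzero invariant a this means that a R contracts to a [A]. *)
Lemma invariant_div (a b : A) x : val a != 0 -> val a * x = val b ->
  exists c : A, val c = x.
Proof.
move=> a0 E; apply: invariant_of => g; apply: (mulfI a0).
by rewrite E -(act_invariant g b) -E rmorphM act_invariant.
Qed.

Lemma act_prod (h : G) (F : G -> R) (F' : G -> R) :
  (forall g, act h (F g) = F' (h * g)%g) ->
  act h (\prod_g F g) = \prod_g F' g.
Proof.
move=> E; rewrite rmorph_prod [RHS](reindex_inj (mulgI h)) /=.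
by apply: eq_bigr => g _; rewrite E.
Qed.

Lemma act_mul g h x : act g (act h x) = act (g * h)%g x.
Proof. by have [_ ->] := act_action. Qed.

Lemma act_id x : act 1%g x = x.
Proof. by have [-> _] := act_action. Qed.

Lemma norm_invariant x : exists a : A, val a = \prod_g act g x.
Proof. by apply: invariant_of => h; apply: act_prod => g; rewrite act_mul. Qed.

Lemma trace_invariant x : exists a : A, val a = \sum_g act g x.
Proof.
apply: invariant_of => h; rewrite rmorph_sum [RHS](reindex_inj (mulgI h)).
by apply: eq_bigr => g _; rewrite /= act_mul.
Qed.

Lemma norm_ideal (I : R -> Prop) x : ideal I -> I x -> I (\prod_g act g x).
Proof.
move=> iI Ix; rewrite (bigD1 1%g) //= act_id; exact: ideal_mull.
Qed.

(* A prime maximal among the ideals disjoint from A \ q contracts to q: if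
   s = y + r x with y in P and s, x in A, then the norm of s - r x = y lies in
   P and differs from a power of s by a multiple of x. *)
Lemma lying_over (q : prime_idealr A) (I : R -> Prop) : noetherian R ->
  ideal I -> (forall a : A, I (val a) -> a \in q) ->
  exists P : prime_idealr R, (forall x, I x -> x \in P) /\
    forall a : A, (val a \in P) = (a \in q).
Proof.
move=> hR iI Iq.
have [|||P [IP PS Pmax]] := @exists_prime_disjoint R hR I
  (fun x => exists2 a : A, a \notin q & x = val a) iI.
- by exists 1; rewrite ?idealr1 ?rmorph1.
- move=> _ _ [a aq ->] [b bq ->]; exists (a * b); last by rewrite rmorphM.
  by rewrite prime_idealrM negb_or aq.
- by move=> x Ix [a /negP aq Ex]; apply/aq/Iq; rewrite -Ex.
exists P; split=> // a; apply/idP/idP.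
  by move/PS => H; apply/negPn/negP => aq; apply: H; exists a.
apply: contraTT => /Pmax[y [r [Py [s sq Es]]]]; apply: contra sq => aq.
have [b Eb] := norm_invariant y.
have bq : b \in q.
  apply/negPn/negP => nbq; apply: (PS (val b)); last by exists b.
  by rewrite Eb; apply: norm_ideal (fun x => x \in P) _ _ Py; apply: idealr_ideal.
pose n := size (index_enum G).
(* Expand the product of the conjugates s - g(r) a: every term but the power of s is divisible by
   a. *)
have [w Ew] : exists w, val b = val (s ^+ n) + val a * w.
  rewrite Eb rmorphXn /n; elim: (index_enum G) => [|g l [w IH]] /=.
    by exists 0; rewrite big_nil mulr0 addr0.
  have Ey : y = val s - r * val a by rewrite -Es addrK.
  rewrite big_cons IH [in act g y]Ey rmorphB rmorphM !act_invariant.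
  exists (val s * w - act g r * (val s ^+ size l + val a * w)).
  by rewrite /= exprS; ring.
(* For nonzero a, w is invariant as a quotient of invariants; if a = 0, then y = s would lie both in
   P and in A \ q. *)
have [a0|a0] := eqVneq a 0.
  move: Es; rewrite a0 rmorph0 mulr0 addr0 => Ey.
  by apply/negPn/negP => sq; apply: (PS y) => //; exists s.
have [c Ec] : exists c : A, val c = w.
  apply: (@invariant_div a (b - s ^+ n)).
    by rewrite invariant_eq0.
  by rewrite rmorphB /= Ew addrC addKr.
have Eb' : b = s ^+ n + a * c.
  by apply: val_inj; rewrite rmorphD rmorphM /= Ec.
apply: (@prime_idealrX _ q s n).
by rewrite -[s ^+ _](addrK (a * c)) -Eb' rpredB // mulrC idealMr.
Qed.

(* Lowering the degree of a monic polynomial over A one root at a time shows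
   that its value at x in P' \ P is never in P. *)
Lemma incomparability (P P' : prime_idealr R) :
  {subset P <= P'} -> (forall a : A, val a \in P' -> val a \in P) ->
  {subset P' <= P}.
Proof.
move=> PP' P'P x xP'; apply/negPn/negP => xP.
(* [horner_rec] reads s as coefficients from the constant term up, so the condition on [last] makes
   the polynomial monic and rules out the empty list. *)
have monic_notin (s : seq R) :
    {in s, forall y, forall g, act g y = y} -> last 0 s = 1 ->
    horner_rec s x \notin P.
  elim: s => [_ /eqP|a s IH sinv] /=; first by rewrite eq_sym oner_eq0.
  have [-> /= ->|s0 slast] := eqVneq s [::].
    by rewrite mul0r add0r idealr1.
  have [b Eb] := invariant_of (sinv a (mem_head _ _)).
  have {}IH : horner_rec s x \notin P.
    apply: IH; first by move=> y ys; apply: sinv; rewrite inE ys orbT.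
    by case: s s0 slast {sinv}.
  apply/negP => H; have aP : a \in P.
    rewrite -Eb; apply: P'P; rewrite Eb.
    by rewrite -[a](addKr (horner_rec s x * x)) rpredD ?rpredN ?idealMr // PP'.
  have : horner_rec s x * x \in P by rewrite -[_ * _](addrK a) rpredB.
  by rewrite prime_idealrM (negPf IH) (negPf xP).
(* The orbit polynomial of x: monic, with invariant coefficients and root x. *)
pose f := \prod_g ('X - (act g x)%:P).
have f_root : f.[x] = 0.
  by rewrite /f (bigD1 1%g) //= act_id hornerM !hornerE subrr mul0r.
have f_inv g : map_poly (act g) f = f.
  rewrite /f rmorph_prod [RHS](reindex_inj (mulgI g)) /=.
  by apply: eq_bigr => h _; rewrite rmorphB /= map_polyX map_polyC /= act_mul.
have /negP : horner_rec f x \notin P; last first.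
  by apply; move: f_root; rewrite /horner => ->; apply: rpred0.
apply: monic_notin => [y /(nthP 0)[i _ <-] g|].
  by rewrite -[in RHS](f_inv g) coef_map.
rewrite -nth_last -lead_coefE; apply/monicP.
by rewrite rpred_prod // => g _; rewrite monicXsubC.
Qed.

(** The norm of an element x of P' lies in P, so some conjugate of x does; prime avoidance makes one
    g work for all of P', and stability of D undoes g. *)
Lemma stable_ideal_transfer (D : R -> Prop) (P P' : prime_idealr R) :
  (forall g x, D x -> D (act g x)) -> (forall x, D x -> x \in P') ->
  (forall a : A, val a \in P' -> val a \in P) ->
  forall x, D x -> x \in P.
Proof.
move=> Dg DP' P'P.
have [|||g _ Pg] := @prime_avoidance R (fun x => x \in P') G
  (fun g x => act g x \in P) (enum G).
- exact: idealr_ideal.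
- move=> g _; split; last by move=> x y; rewrite rmorphM prime_idealrM => /orP.
    split; first by rewrite rmorph0 rpred0.
      by move=> x y; rewrite rmorphD; apply: rpredD.
    by move=> a x; rewrite rmorphM; apply: idealMr.
  by rewrite rmorph1 idealr1.
- move=> x xP'; have [b Eb] := norm_invariant x.
  have : val b \in P.
    apply: P'P; rewrite Eb.
    by apply: norm_ideal (fun x => x \in P') _ _ xP'; apply: idealr_ideal.
  rewrite Eb; apply: contraPP => H.
  suff : \prod_(g : G) act g x \notin P by move/negP.
  elim/big_ind: _ => [|y z yP zP|g _]; first by rewrite idealr1.
    by rewrite prime_idealrM negb_or yP.
  by apply/negP => gx; apply: H; exists g; rewrite ?mem_enum.
move=> x Dx; rewrite -[x]act_id -(mulgV g) -act_mul.
by apply/Pg/DP'/Dg.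
Qed.

(* Dedekind's argument: modulo P the maps [act g] are distinct multiplicative
   characters, hence linearly independent. *)
Lemma trace_notin_prime (P : prime_idealr R) :
  (forall g : G, inertia act P g -> g = 1%g) ->
  exists x, \sum_g act g x \notin P.
Proof.
move=> inertP; apply: contrapT => H.
have {}H x : \sum_g act g x \in P.
  by apply/negPn/negP => xP; apply: H; exists x.
suff indep (s : seq G) (c : G -> R) : uniq s ->
    (forall x, \sum_(g <- s) c g * act g x \in P) -> {in s, forall g, c g \in P}.
  suff : 1 \in P by rewrite idealr1.
  apply: (indep (index_enum G) (fun=> 1) (index_enum_uniq _) _ 1%g) => [x|].
    by rewrite (eq_bigr (fun g => act g x)) // => g _; rewrite mul1r.
  exact: mem_index_enum.
elim: s c => [//|h s IH] c /= /andP[hs us] cP.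
have csP : {in s, forall g, c g \in P}.
  move=> g gs; apply/negPn/negP => cg.
  have /eqP : (g * h^-1)%g = 1%g.
    apply: inertP => y; rewrite -act_mul -[X in _ - X]act_id -(mulgV h) -act_mul.
    set z := act h^-1%g y.
    have : c g * (act g z - act h z) \in P.
      (* The relation at z x minus [act h z] times the relation at x has no h-term, which leaves a
         relation over [s]. *)
      apply: (IH (fun k => c k * (act k z - act h z))) gs => // x.
      have := cP (z * x); have := cP x; rewrite !big_cons => cPx cPzx.
      rewrite (_ : \sum_(k <- s) _ = (c h * act h (z * x) + \sum_(k <- s) c k * act k (z * x))
         - act h z * (c h * act h x + \sum_(k <- s) c k * act k x)).
        by rewrite rpredB // idealMr.
      rewrite rmorphM mulrDr opprD addrACA mulrCA subrr add0r mulr_sumr -sumrB.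
      by apply: eq_bigr => k _; rewrite rmorphM; ring.
    by rewrite prime_idealrM (negPf cg).
  by rewrite -eq_mulgV1 => /eqP gh; rewrite -gh gs in hs.
move=> g; rewrite inE => /predU1P[->|/csP//].
have := cP 1; rewrite big_cons rmorph1 mulr1 => H1.
rewrite -[c h](addrK (\sum_(k <- s) c k * act k 1)) rpredB //.
by rewrite big_seq rpred_sum // => k /csP ck; rewrite rmorph1 mulr1.
Qed.

End InvariantRing.

(** * Dimension, depth and localization *)

(** [supremum] picks a least upper bound if there is one, so existence must be shown: the maximum if
    S is bounded, +oo otherwise. *)
Lemma sup_nat_supremums (S : nat -> Prop) n : S n ->
  supremums [set (m%:Z)%:E | m in (S : set nat)]%classic (sup_nat S).
Proof.
move=> Sn; rewrite /sup_nat /supremum; case: ifPn => [/eqP E|_].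
  by have : (set0 : set (\bar int)) (n%:Z)%:E by rewrite -E; exists n.
apply: xgetPex.
have [[N SN]|unbounded] := pselect (exists N, forall m, S m -> (m <= N)%N).
  have exS : exists m, `[< S m >] by exists n; apply/asboolP.
  have [m /asboolP Sm mmax] := ex_maxnP exS (fun m => fun H : `[< S m >] => SN m (asboolW H)).
  exists (m%:Z)%:E; split=> [_ [k Sk <-]|y]; last by apply; exists m.
  by rewrite lee_fin lez_nat mmax //; apply/asboolP.
exists +oo%E; split=> [_ [k Sk <-]|[y|//|]]; rewrite ?leey //.
  move=> ub; exfalso; apply: unbounded; exists `|y|%N => m Sm.
  have : ((m%:Z)%:E <= y%:E)%E by apply: ub; exists m.
  by rewrite lee_fin -lez_nat => /le_trans; apply; rewrite abszE ler_norm.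
by move=> /(_ (n%:Z)%:E); apply; exists n.
Qed.

Lemma le_sup_nat (S : nat -> Prop) k :
  ((k%:Z)%:E <= sup_nat S)%E <-> exists2 n, S n & (k <= n)%N.
Proof.
split=> [kS|[n Sn kn]]; last first.
  have [ub _] := sup_nat_supremums Sn.
  by apply: le_trans (ub _ _); last (by exists n); rewrite lee_fin lez_nat.
have [[n0 Sn0]|S0] := pselect (exists n, S n); last first.
  move: kS; rewrite /sup_nat (_ : [set _ | _ in _]%classic = set0).
    by rewrite supremum0.
  by rewrite predeqE => x; split=> // -[n Sn _]; apply: S0; exists n.
apply: contrapT => H.
have lek n : S n -> (n < k)%N.
  by move=> Sn; rewrite ltnNge; apply/negP => kn; apply: H; exists n.
have [_ lub] := sup_nat_supremums Sn0.
case: k kS H lek => [|k] kS H lek; first by have := lek _ Sn0.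
have : (sup_nat S <= (k%:Z)%:E)%E.
  by apply: lub => _ [n /lek nk <-]; rewrite lee_fin lez_nat.
by move=> /(le_trans kS); rewrite lee_fin lez_nat ltnn.
Qed.

Lemma lt_sup_nat (S : nat -> Prop) k :
  ((k%:Z)%:E < sup_nat S)%E -> exists2 n, S n & (k < n)%N.
Proof.
move=> kS; apply: contrapT => H.
have [n Sn _] := (le_sup_nat S k).1 (ltW kS).
have [_ lub] := sup_nat_supremums Sn.
have : (sup_nat S <= (k%:Z)%:E)%E.
  apply: lub => _ [m Sm <-]; rewrite lee_fin lez_nat leqNgt.
  by apply/negP => km; apply: H; exists m.
by rewrite leNgt kS.
Qed.

Lemma ideal_gen0 (A : comNzRingType) (x : A) : ideal_gen [::] x <-> x = 0.
Proof. by split=> [[c ->]|->]; [|exists (fun=> 0)]; rewrite big_ord0. Qed.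

Lemma ideal_gen1 (A : comNzRingType) (a x : A) :
  ideal_gen [:: a] x <-> exists w, x = a * w.
Proof.
split=> [[c ->]|[w ->]]; [exists (c 0%N)|exists (fun=> w)];
by rewrite big_ord1 /= mulrC.
Qed.

Lemma ideal_gen2 (A : comNzRingType) (a b x : A) :
  ideal_gen [:: a; b] x <-> exists w z, x = a * w + b * z.
Proof.
split=> [[c ->]|[w [z ->]]].
  exists (c 0%N), (c 1%N); rewrite !big_ord_recl big_ord0 /= addr0.
  by rewrite ![c _ * _]mulrC.
exists (nth 0 [:: w; z]); rewrite !big_ord_recl big_ord0 /= addr0.
by rewrite [w * _]mulrC [z * _]mulrC.
Qed.

(** * Depth through regular pairs and triples *)

Section Depth.
Variables (A : comNzRingType) (M : idealr A).

Definition regular_pair (u v : A) : Prop :=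
  (forall x, u * x = 0 -> x = 0) /\
  (forall x w, v * x = u * w -> exists y, x = u * y).

Lemma depth_ge2 : ((2%:Z)%:E <= depth M)%E ->
  exists u v, [/\ u \in M, v \in M & regular_pair u v].
Proof.
move=> /le_sup_nat[n [s [<- sM [sreg _]]]].
case: s sM sreg => [|u [|v s]] // sM sreg _; exists u, v.
split; [by apply: sM; rewrite !inE eqxx|by apply: sM; rewrite !inE eqxx orbT|].
split=> [x ux|x w vx].
  by apply/ideal_gen0/(sreg 0%N) => //=; apply/ideal_gen0.
by apply/ideal_gen1/(sreg 1%N) => //=; apply/ideal_gen1; exists w.
Qed.

Lemma depth_ge3 : ((3%:Z)%:E <= depth M)%E ->
  exists u v w, [/\ u \in M, v \in M, w \in M, regular_pair u v &
    forall x y z, w * x = u * y + v * z -> exists y' z', x = u * y' + v * z'].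
Proof.
move=> /le_sup_nat[n [s [<- sM [sreg _]]]].
case: s sM sreg => [|u [|v [|w s]]] // sM sreg _; exists u, v, w.
split; try by apply: sM; rewrite !inE eqxx ?orbT.
  split=> [x ux|x y vx].
    by apply/ideal_gen0/(sreg 0%N) => //=; apply/ideal_gen0.
  by apply/ideal_gen1/(sreg 1%N) => //=; apply/ideal_gen1; exists y.
by move=> x y z wx; apply/ideal_gen2/(sreg 2%N) => //=; apply/ideal_gen2; exists y, z.
Qed.

(** Properness of the ideal generated by s comes from [M] being proper, so only the regularity
    clauses are to be checked. *)
Lemma depth_ge_seq (s : seq A) : {subset s <= M} ->
  (forall i a, (i < size s)%N ->
     ideal_gen (take i s) (s`_i * a) -> ideal_gen (take i s) a) ->
  (((size s)%:Z)%:E <= depth M)%E.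
Proof.
move=> sM sreg; apply/le_sup_nat; exists (size s) => //; exists s; split=> //.
split=> // s1; have := ideal_gen_sub (idealr_ideal M) sM s1.
by rewrite idealr1.
Qed.

Lemma ge0_depth : (0 <= depth M)%E.
Proof. by apply: (@depth_ge_seq [::]). Qed.

Lemma ge1_depth u : u \in M -> (forall x, u * x = 0 -> x = 0) ->
  (1 <= depth M)%E.
Proof.
move=> uM u_reg; apply: (@depth_ge_seq [:: u]).
  by move=> x; rewrite inE => /eqP->.
by move=> [|//] a _ /=; rewrite !ideal_gen0; apply: u_reg.
Qed.

Lemma ge2_depth u v : u \in M -> v \in M -> regular_pair u v ->
  ((2%:Z)%:E <= depth M)%E.
Proof.
move=> uM vM [u_reg v_reg]; apply: (@depth_ge_seq [:: u; v]).
  by move=> x; rewrite !inE => /orP[]/eqP->.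
move=> [|[|//]] a _ /=; first by rewrite !ideal_gen0; apply: u_reg.
by rewrite !ideal_gen1 => -[w /v_reg].
Qed.

End Depth.

(** * Localization of a domain at a prime *)

Section LocalizationTheory.
Variables (A : idomainType) (P : prime_idealr A).
Local Notation L := (localization P).

Lemma localization_of a s : s \notin P ->
  exists x : L, val x = tofrac a / tofrac s.
Proof.
move=> sP; have xP : tofrac a / tofrac s \in in_localization P.
  by apply/asboolP; exists a, s.
by exists (Localization xP).
Qed.

Lemma tolocal_subproof a : tofrac a \in in_localization P.
Proof. by apply/asboolP; exists a, 1; rewrite idealr1 tofrac1 divr1. Qed.

Definition tolocal a : L := Localization (tolocal_subproof a).

Lemma tolocalM a b : tolocal (a * b) = tolocal a * tolocal b.
Proof. by apply: val_inj; rewrite rmorphM /= tofracM. Qed.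

Lemma tolocalX a n : tolocal (a ^+ n) = tolocal a ^+ n.
Proof. by apply: val_inj; rewrite rmorphXn /= tofracXn. Qed.

Lemma tolocalD a b : tolocal (a + b) = tolocal a + tolocal b.
Proof. by apply: val_inj; rewrite rmorphD /= tofracD. Qed.

Lemma tolocal1 : tolocal 1 = 1.
Proof. by apply: val_inj; rewrite rmorph1 /= tofrac1. Qed.

Lemma tolocal0 : tolocal 0 = 0.
Proof. by apply: val_inj; rewrite rmorph0 /= tofrac0. Qed.

Lemma tolocal_inj : injective tolocal.
Proof. by move=> a b /(congr1 val) /= /eqP; rewrite tofrac_eq => /eqP. Qed.

Lemma tolocal_unit s : s \notin P -> exists t, tolocal s * t = 1.
Proof.
move=> sP; have [t Et] := localization_of 1 sP.
exists t; apply: val_inj; rewrite rmorphM rmorph1 /= [\val t]Et.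
by rewrite tofrac1 mul1r divff //; exact: notin_prime_neq0 sP.
Qed.

Lemma localizationP x : exists a s, s \notin P /\ tolocal s * x = tolocal a.
Proof.
have /asboolP[a [s [sP Ex]]] := valP x; exists a, s; split=> //.
apply: val_inj; rewrite rmorphM /= [\val x]Ex mulrC divfK //.
exact: notin_prime_neq0 sP.
Qed.

Lemma localization_domain (x y : L) : x * y = 0 -> x != 0 -> y = 0.
Proof.
move=> /(congr1 val); rewrite rmorphM rmorph0 => /eqP; rewrite mulf_eq0.
case/orP => /eqP E; last by move=> _; apply: val_inj; rewrite rmorph0.
by move/eqP; case; apply: val_inj; rewrite rmorph0.
Qed.

Lemma tolocal_max a : (tolocal a \in localization_max P) = (a \in P).
Proof.
apply/asboolP/idP => [[b [s [bP sP /=]]]|aP]; last first.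
  by exists a, 1; rewrite idealr1 tofrac1 divr1.
move=> /(congr1 ( *%R^~ (tofrac s))) /eqP.
rewrite divfK; last exact: notin_prime_neq0 sP.
rewrite -tofracM tofrac_eq => /eqP E.
by move: bP; rewrite -E prime_idealrM (negPf sP) orbF.
Qed.

Lemma localization_max_out x : x \notin localization_max P ->
  exists y, x * y = 1.
Proof.
have [a [s [sP Ex]]] := localizationP x; have [t Et] := tolocal_unit sP.
have {Ex}-> : x = tolocal a * t by rewrite -Ex mulrAC Et mul1r.
move=> aP; have /tolocal_unit[u Eu] : a \notin P.
  by apply: contra aP => aP; rewrite mulrC idealMr // tolocal_max.
by exists (u * tolocal s); rewrite mulrACA Eu mul1r mulrC.
Qed.

Lemma prime_sub_localization_max (Q : prime_idealr L) :
  {subset Q <= localization_max P}.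
Proof.
move=> x xQ; apply: contraT => /localization_max_out[y xy].
by have := idealr1 Q; rewrite -xy mulrC idealMr.
Qed.

Lemma localization_contract (Q : prime_idealr L) :
  exists q : prime_idealr A, forall a, (a \in q) = (tolocal a \in Q).
Proof.
have [|q qP] := @prime_idealr_of A (fun a => tolocal a \in Q).
  split; last by move=> a b; rewrite tolocalM prime_idealrM => /orP.
    split; first by rewrite tolocal0 rpred0.
      by move=> a b; rewrite tolocalD; apply: rpredD.
    by move=> a b; rewrite tolocalM; apply: idealMr.
  by rewrite tolocal1 idealr1.
by exists q => a; apply/idP/idP => /qP.
Qed.

Lemma localization_extend (q : prime_idealr A) : {subset q <= P} ->
  exists Q : prime_idealr L, forall a, (tolocal a \in Q) = (a \in q).
Proof.
move=> qP.
(* The extension of q to [L], with denominators cleared. *)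
pose I (x : L) := exists a s, [/\ a \in q, s \notin P & tolocal s * x = tolocal a].
have Iq a : I (tolocal a) <-> a \in q.
  split=> [[b [s [bq sP]]]|aq]; last by exists a, 1; rewrite idealr1 tolocal1 mul1r.
  rewrite -tolocalM => /tolocal_inj E.
  move: bq; rewrite -E prime_idealrM => /orP[/qP sP'|//].
  by rewrite sP' in sP.
have I_sat s x : s \notin P -> I (tolocal s * x) -> I x.
  move=> sP [a [t [aq tP E]]]; exists a, (t * s); split=> //.
    exact: notin_primeM.
  by rewrite tolocalM -mulrA.
have iI : ideal I.
  split.
  - by rewrite -tolocal0; apply/Iq/rpred0.
  - move=> x y [a [s [aq sP Ex]]] [b [t [bq tP Ey]]].
    exists (t * a + s * b), (s * t); split.
    + by rewrite rpredD ?idealMr.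
    + exact: notin_primeM.
    + by rewrite tolocalD !tolocalM -Ex -Ey; ring.
  - move=> y x [a [s [aq sP Ex]]]; have [b [t [tP Ey]]] := localizationP y.
    exists (b * a), (t * s); split; [exact: idealMr|exact: notin_primeM|].
    by rewrite !tolocalM -Ex -Ey; ring.
have [|Q QP] := @prime_idealr_of L I.
  split=> //; first by rewrite -tolocal1 => /Iq; rewrite idealr1.
  move=> x y; have [a [s [sP Ex]]] := localizationP x.
  have [b [t [tP Ey]]] := localizationP y => Ixy.
  have : I (tolocal (a * b)).
    rewrite tolocalM -Ex -Ey mulrACA.
    by have [_ _ IM] := iI; apply: IM.
  move/Iq; rewrite prime_idealrM => /orP[]/Iq; rewrite -?Ex -?Ey => /I_sat H.
    by left; apply: H.
  by right; apply: H.
by exists Q => a; apply/idP/idP => [/QP/Iq|/Iq/QP].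
Qed.

(** Primes of A_P correspond to primes of A inside P by contraction and extension, so the dimension
    of A_P is read off from chains in A. *)
Lemma localization_chain n :
  (exists Q : nat -> prime_idealr L, prime_chain n Q) <->
  exists q : nat -> prime_idealr A,
    prime_chain n q /\ forall i, (i <= n)%N -> {subset q i <= P}.
Proof.
split=> [[Q Qchain]|[q [qchain qP]]].
  have [q qE] := choice (fun i => localization_contract (Q i)).
  exists q; split=> [i /Qchain[QQ nQQ]|i _ a]; last first.
    by rewrite qE => /prime_sub_localization_max; rewrite tolocal_max.
  split=> [a|H]; first by rewrite !qE => /QQ.
  apply: nQQ => x xQ; have [a [s [sP Ex]]] := localizationP x.
  have : tolocal a \in Q i by rewrite -qE H // qE -Ex idealMr.
  rewrite -Ex prime_idealrM => /orP[sQ|//].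
  by have := prime_sub_localization_max sQ; rewrite tolocal_max (negPf sP).
(* A chain is indexed by all naturals; beyond n any prime will do. *)
have /choice[Q QE] : forall i, exists Q : prime_idealr L,
    (i <= n)%N -> forall a, (tolocal a \in Q) = (a \in q i).
  move=> i; have [le_in|_] := boolP (i <= n)%N; last first.
    by have [Q _] := localization_extend (qP 0%N isT); exists Q.
  by have [Q QE] := localization_extend (qP i le_in); exists Q.
exists Q => i lt_in; have [qq nqq] := qchain i lt_in; split=> [x xQ|H].
  have [a [s [sP Ex]]] := localizationP x.
  have : tolocal s * x \in Q i.+1.
    by rewrite Ex QE // qq // -QE ?(ltnW lt_in) // -Ex idealMr.
  rewrite prime_idealrM => /orP[sQ|//].
  by have := prime_sub_localization_max sQ; rewrite tolocal_max (negPf sP).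
by apply: nqq => a aq; rewrite -QE ?(ltnW lt_in) // H // QE.
Qed.

End LocalizationTheory.

(** * Serre's condition S(2) *)

(** A longer chain is also a chain of length k, since [prime_chain k] constrains only the first k
    steps. *)
Lemma krull_dim_ge (A : comNzRingType) k :
  ((k%:Z)%:E <= krull_dim A)%E <->
  exists P : nat -> prime_idealr A, prime_chain k P.
Proof.
split=> [/le_sup_nat[n [P Pn] kn]|H]; last by apply/le_sup_nat; exists k.
by exists P => i ik; apply/Pn/(leq_trans ik).
Qed.

(** In dimension at most 1 the bound is automatic for a domain: in dimension 1 any nonzero element
    of the maximal ideal is regular. *)
Lemma serre2P (A : idomainType) : (forall P : prime_idealr A,
    ((2%:Z)%:E <= krull_dim (localization P))%E ->
    ((2%:Z)%:E <= depth (localization_max P))%E) -> serre 2 A.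
Proof.
move=> H P; have [/H dP|] := boolP ((2%:Z)%:E <= krull_dim (localization P))%E.
  by rewrite ge_min dP.
rewrite -ltNge => lt2; rewrite ge_min; apply/orP; right.
have [ge1|] := boolP ((1%:Z)%:E <= krull_dim (localization P))%E.
  apply: (@le_trans _ _ 1%:E).
    rewrite leNgt; apply/negP => /(@lt_sup_nat _ 1)[n Sn n1].
    by have := lt2; rewrite ltNge => /negP; apply; apply/le_sup_nat; exists n.
  have [Q /(_ 0%N isT)[_ nQ]] := (krull_dim_ge _ 1).1 ge1.
  have [x [xQ x0]] : exists x, x \in Q 1%N /\ x != 0.
    apply: contrapT => nx; apply: nQ => x xQ.
    have [->|x0] := eqVneq x 0; first exact: rpred0.
    by exfalso; apply: nx; exists x.
  apply: (@ge1_depth _ _ x); first exact: (prime_sub_localization_max xQ).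
  by move=> y /localization_domain; apply.
rewrite -ltNge => lt1; apply: le_trans (ge0_depth _).
rewrite leNgt; apply/negP => /(@lt_sup_nat _ 0)[n Sn n0].
by have := lt1; rewrite ltNge => /negP; apply; apply/le_sup_nat; exists n.
Qed.

(** The hypothesis says that x / a enters R_P after multiplication by a power of any element of P;
    applied to a regular pair in P R_P, it puts x / a in R_P. *)
Lemma integral_in_localization (R : idomainType) (P : prime_idealr R) (a x : R) :
  a != 0 -> ((2%:Z)%:E <= depth (localization_max P))%E ->
  (forall u, u \in P -> exists k s e, s \notin P /\ s * u ^+ k * x = a * e) ->
  exists s e, s \notin P /\ s * x = a * e.
Proof.
move=> a0 /depth_ge2[u [v [uP vP [u_reg v_reg]]]] H.
have pow_integral y : y \in localization_max P ->
    exists k e, y ^+ k * tolocal P x = tolocal P a * e.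
  move=> yP; have [c [t [tP Ey]]] := localizationP y.
  have /H[k [s [e [sP E]]]] : c \in P by rewrite -tolocal_max -Ey idealMr.
  have [s' Es'] := tolocal_unit sP; have [t' Et'] := tolocal_unit tP.
  exists k, (tolocal P e * s' * t' ^+ k).
  rewrite !mulrA -tolocalM -E !tolocalM tolocalX -Ey exprMn.
  rewrite (_ : _ * _ * _ = tolocal P s * s' * (tolocal P t * t') ^+ k * (y ^+ k * tolocal P x)).
    by rewrite Es' Et' expr1n !mul1r.
  by rewrite exprMn; ring.
have [k [e Ee]] := pow_integral u uP; have [m [e' Ee']] := pow_integral v vP.
have [|z Ez] := regular_pair_integral u_reg v_reg _ Ee Ee'.
  by move=> y /localization_domain; apply; rewrite -tolocal0 (inj_eq (@tolocal_inj _ P)).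
have [c [s [sP Ec]]] := localizationP z; exists s, c; split=> //.
by apply: (@tolocal_inj _ P); rewrite !tolocalM Ez -Ec mulrCA.
Qed.

Section Serre2.
Variables (G : finGroupType) (R : idomainType) (act : G -> {rmorphism R -> R}).
Hypothesis act_action : ring_action act.
Hypothesis R_noetherian : noetherian R.
Hypothesis A_noetherian : noetherian (invariants act).
Local Notation A := (invariants act).

Lemma zero_ideal : ideal (fun x : R => x = 0).
Proof. by split=> // [x y -> ->|a x ->]; rewrite ?addr0 ?mulr0. Qed.

Lemma lying_over0 (q : prime_idealr A) :
  exists P : prime_idealr R, forall a : A, (val a \in P) = (a \in q).
Proof.
have [|P [_ PE]] := lying_over act_action (q := q) R_noetherian zero_ideal.
  by move=> a /eqP; rewrite invariant_eq0 => /eqP->; apply: rpred0.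
by exists P.
Qed.

Lemma going_up (P : prime_idealr R) (q q' : prime_idealr A) :
  (forall a : A, (val a \in P) = (a \in q)) -> {subset q <= q'} ->
  exists P' : prime_idealr R, {subset P <= P'} /\
    forall a : A, (val a \in P') = (a \in q').
Proof.
move=> Pq qq'; apply: (lying_over act_action R_noetherian).
  exact: idealr_ideal.
by move=> a; rewrite Pq; apply: qq'.
Qed.

(** Lying over and going up lift a chain of three primes and then q itself; inclusions stay strict
    because the contractions differ. *)
Lemma height2_over (q : prime_idealr A) :
  ((2%:Z)%:E <= krull_dim (localization q))%E ->
  exists P : prime_idealr R, (forall a : A, (val a \in P) = (a \in q)) /\
    ((2%:Z)%:E <= krull_dim (localization P))%E.
Proof.
move=> /krull_dim_ge/localization_chain[r [rchain rq]].
have [r01 n01] := rchain 0%N isT; have [r12 n12] := rchain 1%N isT.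
have [P0 E0] := lying_over0 (r 0%N).
have [P1 [P01 E1]] := going_up E0 r01.
have [P2 [P12 E2]] := going_up E1 r12.
have [P [P2P EP]] := going_up E2 (rq 2%N isT).
exists P; split=> //; apply/krull_dim_ge/localization_chain.
exists (fun i => nth P0 [:: P0; P1; P2] i); split=> [[|[|//]] _|[|[|[|//]]] _] /=.
- by split=> // H; apply: n01 => a; rewrite -E0 -E1; apply: H.
- by split=> // H; apply: n12 => a; rewrite -E1 -E2; apply: H.
- by move=> x /P01/P12/P2P.
- by move=> x /P12/P2P.
- exact: P2P.
Qed.

(* Otherwise q consists of zero divisors modulo a A_q, so q x lies in a A_q for
   some x outside a A_q.  The fraction x / a is then integral over a prime P
   above q, where depth is at least 2 and q R_P is P-primary. *)
Lemma invariants_serre2 : serre 2 R -> serre 2 A.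
Proof.
move=> hS; apply: serre2P => q dim_q.
have [P [PE dim_P]] := height2_over dim_q.
have depth_P : ((2%:Z)%:E <= depth (localization_max P))%E.
  by apply: le_trans (hS P); rewrite le_min lexx.
have [a [aq a0]] : exists a, a \in q /\ a != 0.
  have [r [rchain rq]] := (localization_chain _ _).1 ((krull_dim_ge _ 2).1 dim_q).
  have [_ n01] := rchain 0%N isT; apply: contrapT => na; apply: n01 => a ar.
  have [->|a0] := eqVneq a 0; first exact: rpred0.
  by exfalso; apply: na; exists a; split=> //; apply: rq ar.
(* N is the contraction of a A_q to [A]. *)
pose N x := exists s e, s \notin q /\ s * x = a * e.
have NP x : N x <-> exists w, tolocal q x = tolocal q a * w.
  split=> [[s [e [sq E]]]|[w Ew]].
    have [s' Es'] := tolocal_unit sq; exists (tolocal q e * s').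
    by rewrite mulrA -tolocalM -E tolocalM mulrAC Es' mul1r.
  have [e [s [sq Es]]] := localizationP w; exists s, e; split=> //.
  by apply: (@tolocal_inj _ q); rewrite !tolocalM Ew -Es mulrCA.
have [[b [bq b_reg]]|no_reg] :=
  pselect (exists b, b \in q /\ forall x, N (b * x) -> N x).
  apply: (@ge2_depth _ _ (tolocal q a) (tolocal q b)); rewrite ?tolocal_max //.
  split=> [x /localization_domain|x w Ew].
    by apply; rewrite -(tolocal0 q) (inj_eq (@tolocal_inj _ q)).
  have [c [s [sq Es]]] := localizationP x; have [s' Es'] := tolocal_unit sq.
  have /NP[y Ey] : N c.
    apply/b_reg/NP; exists (tolocal q s * w).
    by rewrite tolocalM -Es mulrCA Ew mulrCA.
  exists (y * s'); rewrite mulrA -Ey -Es.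
  by rewrite mulrAC Es' mul1r.
have iN : ideal N.
  split.
  - by exists 1, 0; rewrite idealr1 !mulr0.
  - move=> x y [s [e [sq E]]] [t [f [tq F]]]; exists (s * t), (t * e + s * f).
    split; first exact: notin_primeM.
    by ring: E F.
  - move=> c x [s [e [sq E]]]; exists s, (c * e); split=> //.
    by rewrite mulrCA E mulrCA.
have [||x Nx qx] := @noetherian_zero_divisors A (fun b => b \in q) N A_noetherian
  (idealr_ideal _) iN.
- move=> [s [e [sq]]]; rewrite mulr1 => E; move: sq.
  by rewrite E mulrC idealMr.
- move=> b bq; apply: contrapT => H; apply: no_reg; exists b; split=> // x Nbx.
  by apply: contrapT => Nx; apply: H; exists x.
(* D is the ideal of denominators of x / a over R localized at the complement of q in [A]. *)
pose D d := exists s : A, s \notin q /\ exists e, val s * d * val x = val a * e.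
have va0 : val a != 0 by rewrite invariant_eq0.
have iD : ideal D.
  split.
  - by exists 1; rewrite idealr1; split=> //; exists 0; rewrite !(mulr0, mul0r).
  - move=> d d' [s [sq [e E]]] [t [tq [f F]]]; exists (s * t).
    split; first exact: notin_primeM.
    exists (val t * e + val s * f).
    by rewrite val_invariantM [RHS]mulrDr [val a * (val t * e)]mulrCA -E [val a * (val s * f)]mulrCA -F; ring.
  - move=> c d [s [sq [e E]]]; exists s; split=> //; exists (c * e).
    by rewrite mulrCA -mulrA E mulrCA.
have Dq (d : A) : D (val d) -> d \in q.
  move=> [s [sq [e E]]]; apply/negPn/negP => dq; apply: Nx.
  have [f Ef] : exists f : A, val f = e.
    by apply: (@invariant_div _ _ _ a (s * d * x)) => //; rewrite !val_invariantM.
  exists (s * d), f; split; first exact: notin_primeM.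
  by apply: val_inj; rewrite !val_invariantM Ef.
have qD (d : A) : d \in q -> D (val d).
  move=> /qx[s [e [sq E]]]; exists s; split=> //; exists (val e).
  by rewrite -!val_invariantM -E mulrA.
have [P' [DP' P'E]] := lying_over act_action (q := q) R_noetherian iD Dq.
(* P and P' both lie over q, and D is stable under G because s, x and a are invariant. *)
have DP : forall d, D d -> d \in P.
  apply: (stable_ideal_transfer act_action (P' := P')) => //.
    move=> g d [s [sq [e E]]]; exists s; split=> //; exists (act g e).
    by rewrite -(act_invariant g s) -(act_invariant g x) -(act_invariant g a)
       -!rmorphM E.
  by move=> b; rewrite P'E PE.
have [|||s [e [sP Es]]] := @integral_in_localization R P (val a) (val x).
- by [].
- by [].
- move=> u uP; apply: contrapT => H.
  (* If no s u^k with s outside P were a denominator, some prime P'' containing D would miss all of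
     them. It lies inside P and contains q, so it equals P by incomparability and contains u. *)
  pose S y := exists k s, s \notin P /\ y = s * u ^+ k.
  have [|||P'' [DP'' P''S _]] := exists_prime_disjoint R_noetherian iD (S := S).
  + by exists 0%N, 1; rewrite idealr1 mulr1.
  + move=> _ _ [k [s [sP ->]]] [m [t [tP ->]]]; exists (k + m)%N, (s * t).
    by rewrite exprD mulrACA; split=> //; apply: notin_primeM.
  + move=> y [t [tq [e E]]] [k [s [sP Ey]]]; apply: H.
    exists k, (val t * s), e; rewrite -E Ey !mulrA; split=> //.
    by apply: notin_primeM => //; rewrite PE.
  apply: (P''S u); last by exists 1%N, 1; rewrite idealr1 mul1r.
  apply: (incomparability act_action (P := P'')) uP.
    move=> y yP''; apply: contraT => yP; exfalso; apply: (P''S y yP'').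
    by exists 0%N, y; rewrite mulr1.
  by move=> b; rewrite PE => /qD/DP''.
suff : s \in P by rewrite (negPf sP).
by apply: DP; exists 1; rewrite idealr1; split=> //; exists e; rewrite rmorph1 mul1r.
Qed.

End Serre2.

(** * Regular triples and traces *)

Definition regular_triple (B : comNzRingType) (u v w : B) : Prop :=
  regular_pair u v /\
  forall x y z, w * x = u * y + v * z -> exists y' z', x = u * y' + v * z'.

Section RegularTriple.
Variable B : comNzRingType.
Implicit Types u v w : B.

Lemma regular_pair_pows u v i j :
  regular_pair u v -> regular_pair (u ^+ i) (v ^+ j).
Proof.
move=> [u_reg v_reg]; split; first by move=> x; apply: regular_pow.
by move=> x w; apply: regular_pair_pow.
Qed.

(** Passing to powers will turn a regular triple into one made of traces. Writing x = u^i s + v t by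
    induction and cancelling u^i, one finds w s in (u, v), hence s in (u, v). *)
Lemma regular_triple_powl u v w i :
  regular_triple u v w -> regular_triple (u ^+ i) v w.
Proof.
move=> [uv w_reg]; split; first by have := regular_pair_pows i 1 uv.
elim: i => [|i IH] x y z E; first by exists x, 0; rewrite mulr0 addr0 mul1r.
have [|s [t Ex]] := IH x (u * y) z; first by rewrite mulrA -exprSr.
have [ui_reg v_reg] := regular_pair_pows i 1 uv.
have [|r Er] := v_reg (z - w * t) (w * s - u * y).
  rewrite expr1 !mulrBr -[v * z](addKr (u ^+ i.+1 * y)) -E Ex exprSr; ring.
have Es : w * s = u * y + v * r.
  apply/subr0_eq/ui_reg.
  rewrite (_ : _ * _ = (u ^+ i * (w * s - u * y)) - v * (u ^+ i * r)); last by ring.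
  by rewrite -Er; move/eqP: E; rewrite Ex -subr_eq0 exprSr => /eqP<-; ring.
have [s1 [s2 E']] := w_reg _ _ _ Es.
by exists s1, (u ^+ i * s2 + t); rewrite Ex E' exprSr; ring.
Qed.

(** With x = u s + v^j t by induction, regularity of v^j modulo u puts w t in (u, v), hence t as
    well. *)
Lemma regular_triple_powm u v w j :
  regular_triple u v w -> regular_triple u (v ^+ j) w.
Proof.
move=> [uv w_reg]; split; first by have := regular_pair_pows 1 j uv.
elim: j => [|j IH] x y z E; first by exists 0, x; rewrite mulr0 add0r mul1r.
have [|s [t Ex]] := IH x y (v * z); first by rewrite mulrA -exprSr.
have [_ v_reg] := regular_pair_pows 1 j uv.
have [|r Er] := v_reg (w * t - v * z) (y - w * s).
  by move/eqP: E; rewrite Ex -subr_eq0 exprSr => /eqP E; apply/eqP; rewrite -subr_eq0 -E; apply/eqP; ring.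
have [|t1 [t2 E']] := w_reg t r z.
  by rewrite -[u]expr1 -Er; ring.
by exists (s + v ^+ j * t1), t2; rewrite Ex E' exprSr; ring.
Qed.

Lemma regular_triple_powr u v w k :
  regular_triple u v w -> regular_triple u v (w ^+ k).
Proof.
move=> [uv w_reg]; split=> //.
elim: k => [|k IH] x y z; first by rewrite mul1r => ->; exists y, z.
by rewrite exprSr -mulrA => /IH[y' [z' /w_reg]].
Qed.

End RegularTriple.

(** * Traces and coboundaries for a cyclic group *)

Section CyclicTrace.
Variables (G : finGroupType) (R : idomainType) (act : G -> {rmorphism R -> R}).
Hypothesis act_action : ring_action act.
Variable sigma : G.
Hypothesis sigma_gen : [set: G] = <[sigma]>%g.
Local Notation A := (invariants act).

Lemma invariant_of_generator x : act sigma x = x -> exists a : A, val a = x.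
Proof.
move=> sx; apply: invariant_of => g.
have /cycleP[k ->] : g \in <[sigma]>%g by rewrite -sigma_gen inE.
elim: k => [|k IH]; first by rewrite expg0 act_id.
by rewrite expgS -act_mul // IH.
Qed.

Lemma sum_cycle (F : G -> R) : \sum_g F g = \sum_(i < #|G|) F (sigma ^+ i)%g.
Proof.
have oG : #|G| = #[sigma]%g by rewrite orderE -sigma_gen cardsT.
rewrite (reindex (fun i : 'I_#|G| => (sigma ^+ i)%g)) //.
apply/onW_bij/inj_card_bij; last by rewrite card_ord.
move=> i j /eqP; rewrite eq_expg_mod_order -oG !modn_small //.
by move/eqP/val_inj.
Qed.

(* H^1(G, R) of a cyclic group is the kernel of the trace modulo the image of
   sigma - 1; it contains 1 as |G| = 0 in R, and is killed by traces. *)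
Lemma trace_coboundary x : #|G|%:R = 0 :> R ->
  exists y, act sigma y - y = \sum_g act g x.
Proof.
(* Summation by parts: sigma - 1 turns [y k] into a sum of conjugates minus the boundary term k
   sigma^k x, which vanishes at k = |G|. *)
move=> G0; pose y k := - \sum_(i < k) i%:R * act (sigma ^+ i)%g x.
have partial k : act sigma (y k) - y k =
    \sum_(i < k) act sigma (act (sigma ^+ i)%g x) - k%:R * act (sigma ^+ k)%g x.
  elim: k => [|k IH]; first by rewrite /y !big_ord0 oppr0 rmorph0 mul0r !subr0.
  have yS : y k.+1 = y k - k%:R * act (sigma ^+ k)%g x.
    by rewrite /y big_ord_recr opprD.
  rewrite yS rmorphB rmorphM rmorph_nat big_ord_recr /=.
  rewrite [in RHS]expgS -[in RHS]act_mul //.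
  by rewrite -[act sigma (y k)](subrK (y k)) IH -natr1; ring.
exists (y #|G|); rewrite partial G0 mul0r subr0 -rmorph_sum.
have [a Ea] := trace_invariant act_action x.
by rewrite -(sum_cycle (fun g => act g x)) -Ea act_invariant.
Qed.

End CyclicTrace.

(** * Failure of S(3) *)

(** Noetherianity yields a maximal ideal over x R when x is not a unit, and this ideal must be
    [M]. *)
Lemma local_ring_unit (R : comNzRingType) (M : idealr R) x :
  noetherian R -> local_ring M -> x \notin M -> exists y, x * y = 1.
Proof.
move=> hR [_ Muniq] xM; apply: contrapT => nx.
have ix : ideal (fun z => exists y, z = x * y).
  split; first by exists 0; rewrite mulr0.
    by move=> _ _ [y ->] [z ->]; exists (y + z); rewrite mulrDr.
  by move=> a _ [y ->]; exists (a * y); rewrite mulrCA.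
have [||N [[iN xN N1] Nmax]] := @noetherian_maximal R hR
  (fun N => [/\ ideal N, forall y, N (x * y) & ~ N 1]).
- by move=> N [].
- exists (fun z => exists y, z = x * y); split=> //; first by move=> y; exists y.
  by move=> [y E]; apply: nx; exists y.
have [N' N'E] := idealr_of iN N1.
have N'max : maximal_ideal N'.
  move=> J N'J z; apply/idP/idP => [zJ|/N'J//].
  apply/N'E/(Nmax (fun z => z \in J)) => //; last by move=> y /N'E/N'J.
  split; [exact: idealr_ideal| |by rewrite idealr1].
  by move=> y; apply/N'J/N'E.
by move: xM; rewrite -(Muniq N' N'max); have := xN 1; rewrite mulr1 => /N'E->.
Qed.

Section NotSerre3.
Variables (G : finGroupType) (R : idomainType) (M : idealr R)
  (act : G -> {rmorphism R -> R}).
Hypothesis act_action : ring_action act.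
Hypothesis R_noetherian : noetherian R.
Hypothesis R_local : local_ring M.
Hypothesis act_wild : acts_wildly act M.
Local Notation A := (invariants act).

Let A_noetherian : noetherian A. Proof. by case: act_wild. Qed.

Let act_residue g a : act g a - a \in M.
Proof. by case: act_wild => /(_ g a)/eqP; rewrite Quotient.idealrBE. Qed.

Let act_free (P : prime_idealr R) x : x \in M -> x \notin P ->
  forall g : G, inertia act P g -> g = 1%g.
Proof.
move=> xM xP; have [_ + _ _] := act_wild; apply.
by move=> PM; rewrite PM xM in xP.
Qed.

(** Primality holds because elements outside [M] are units of R. *)
Lemma invariant_max : exists m : prime_idealr A, forall a, (a \in m) = (val a \in M).
Proof.
have [|m mE] := @prime_idealr_of A (fun a => val a \in M).
  split.
  - split; first by rewrite rmorph0 rpred0.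
      by move=> a b aM bM; rewrite rmorphD rpredD.
    by move=> a b bM; rewrite val_invariantM idealMr.
  - by rewrite rmorph1 idealr1.
  - move=> a b; rewrite val_invariantM => abM.
    have [aM|/(local_ring_unit R_noetherian R_local)[y Ey]] := boolP (val a \in M).
      by left.
    by right; rewrite -[val b]mul1r -Ey mulrAC mulrC idealMr.
by exists m => a; apply/idP/idP => /mE.
Qed.

(** [A] is already local: an invariant outside [M] has an invariant inverse. Regular sequences of
    A_m therefore live in [A]. *)
Lemma localization_invariant_max (m : prime_idealr A) x :
  (forall a, (a \in m) = (val a \in M)) -> exists a, x = tolocal m a.
Proof.
move=> mE; have [a [s [sm Ex]]] := localizationP x.
have [y Ey] : exists y, val s * y = 1.
  by apply: local_ring_unit R_noetherian R_local _; rewrite -mE.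
have [t Et] : exists t : A, val t = y.
  apply: (@invariant_div _ _ _ s 1); last by rewrite rmorph1.
  by apply: contraNneq sm => s0; rewrite mE s0 rpred0.
exists (t * a); rewrite tolocalM -Ex mulrA -tolocalM.
suff -> : t * s = 1 by rewrite tolocal1 mul1r.
by apply: val_inj; rewrite val_invariantM Et mulrC Ey rmorph1.
Qed.

(* Every prime other than M avoids some trace. *)
Lemma trace_radical (D : R -> Prop) x : ideal D ->
  (forall y, D (\sum_g act g y)) -> x \in M -> exists k, D (x ^+ k).
Proof.
move=> iD Dtr xM; apply: contrapT => H.
have [|P [DP xP]] := @exists_prime_avoiding_powers R R_noetherian D x iD.
  by move=> k Dk; apply: H; exists k.
have [y] := trace_notin_prime act_action (act_free xM xP).
by rewrite DP.
Qed.

Definition is_trace (a : A) : Prop := exists y, val a = \sum_g act g y.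

Lemma is_trace_ideal : ideal is_trace.
Proof.
split.
- by exists 0; rewrite rmorph0 big1 // => g _; rewrite rmorph0.
- move=> a b [y Ey] [z Ez]; exists (y + z).
  by rewrite val_invariantD Ey Ez -big_split; apply: eq_bigr => g _; rewrite rmorphD.
- move=> a b [y Ey]; exists (val a * y); rewrite val_invariantM Ey mulr_sumr.
  by apply: eq_bigr => g _; rewrite rmorphM act_invariant.
Qed.

(** As in [trace_radical], now inside [A]: a prime of [A] avoiding a lies under a prime of R
    avoiding it, which misses some trace. *)
Lemma trace_invariant_radical (a : A) : val a \in M -> exists k, is_trace (a ^+ k).
Proof.
move=> aM; apply: contrapT => H.
have [|q [trq aq]] := @exists_prime_avoiding_powers A A_noetherian is_trace a is_trace_ideal.
  by move=> k Dk; apply: H; exists k.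
have [P PE] := lying_over0 act_action R_noetherian q.
have aP : val a \notin P by rewrite PE.
have [y] := trace_notin_prime act_action (act_free aM aP).
have [b Eb] := trace_invariant act_action y.
by rewrite -Eb PE trq //; exists y.
Qed.

Hypothesis G_cyclic : cyclic [set: G].
Hypothesis card_G0 : #|G|%:R = 0 :> R.
Hypothesis M_depth : ((2%:Z)%:E <= depth M)%E.

(* With (sigma - 1) y_d = d for each trace d, the invariants
   u_de = e y_d - d y_e satisfy c u_ab = b u_ac - a u_bc.  So a regular triple
   a, b, c gives u_ab = a s + b t, and the fraction (y_a - t) / a, on which
   sigma - 1 takes the value 1, becomes integral after multiplication by any
   trace, hence is integral.  But sigma - 1 maps R into M. *)
Lemma no_regular_triple_of_traces (a b c : A) :
  is_trace a -> is_trace b -> is_trace c -> ~ regular_triple a b c.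
Proof.
move=> tra trb trc [[a_reg b_reg] c_reg].
have [sigma sigma_gen] := cyclicP G_cyclic.
have cobound (d : A) : is_trace d -> exists y, act sigma y = y + val d.
  move=> [x Ex]; have [y Ey] := trace_coboundary act_action sigma_gen x card_G0.
  by exists y; rewrite Ex -Ey addrC subrK.
have [[ya Ea] [yb Eb] [yc Ec]] := And3 (cobound a tra) (cobound b trb) (cobound c trc).
have cross (d e : A) yd ye : act sigma yd = yd + val d -> act sigma ye = ye + val e ->
    exists u : A, val u = val e * yd - val d * ye.
  move=> Ed Ee; apply: (invariant_of_generator act_action sigma_gen).
  by rewrite rmorphB !rmorphM !act_invariant Ed Ee; ring.
have [uab Eab] := cross a b ya yb Ea Eb.
have [uac Eac] := cross a c ya yc Ea Ec.
have [ubc Ebc] := cross b c yb yc Eb Ec.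
have [|s [t Est]] := c_reg uab (- ubc) uac.
  apply: val_inj; rewrite val_invariantD !val_invariantM val_invariantN Eab Eac Ebc; ring.
pose n := ya - val t.
have a0 : a != 0.
  apply/eqP => a0; have := a_reg 1; rewrite a0 mul0r => /(_ erefl)/eqP.
  by rewrite oner_eq0.
have va0 : val a != 0 by rewrite invariant_eq0.
pose D z := exists e, z * n = val a * e.
have iD : ideal D.
  split; first by exists 0; rewrite mul0r mulr0.
    by move=> y z [e Ee] [f Ef]; exists (e + f); rewrite mulrDl Ee Ef mulrDr.
  by move=> y z [e Ee]; exists (y * e); rewrite -mulrA Ee mulrCA.
have Dtr x : D (\sum_g act g x).
  have [d Ed] := trace_invariant act_action x; rewrite -Ed.
  have [yd Eyd] : exists y, act sigma y = y + val d by apply: cobound; exists x.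
  have [uad Ead] := cross a d ya yd Ea Eyd.
  have [ubd Ebd] := cross b d yb yd Eb Eyd.
  (* From b u_ad = d u_ab + a u_bd and u_ab = a s + b t one gets b (u_ad - d t) = a (u_bd + d s). *)
  have [|e Ee] := b_reg (uad - d * t) (ubd + d * s).
    apply: val_inj; rewrite !(val_invariantD, val_invariantN, val_invariantM) Ead Ebd.
    have {Est}Est := congr1 val Est; rewrite Eab val_invariantD !val_invariantM in Est.
    rewrite mulrDr mulrN [val b * (val d * val t)]mulrCA.
    rewrite (_ : val b * val t = val b * ya - val a * yb - val a * val s); first by ring.
    by rewrite Est addrC addKr.
  exists (val e + yd); rewrite [RHS]mulrDr -val_invariantM -Ee.
  by rewrite !(val_invariantD, val_invariantN, val_invariantM) Ead /n; ring.
have [u [v [uM vM [u_reg v_reg]]]] := depth_ge2 M_depth.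
have [k [e Ee]] := trace_radical iD Dtr uM.
have [m [f Ef]] := trace_radical iD Dtr vM.
have [|z Ez] := regular_pair_integral u_reg v_reg _ Ee Ef.
  by move=> x /eqP; rewrite mulf_eq0 (negPf va0) => /eqP.
(* Here z = n / a and sigma n = n + a, so (sigma - 1) z = 1, which would lie in [M]. *)
have := act_residue sigma z; rewrite (_ : _ - _ = 1) ?idealr1 //.
apply: (mulfI va0); rewrite mulrBr -{1}(act_invariant sigma a) -rmorphM -Ez.
by rewrite /n rmorphB act_invariant Ea; ring.
Qed.

(** A chain in R contracts to a chain below m, strict by incomparability, so S(n) with n > 2 would
    give a regular triple in A_m = [A], whose suitable powers are traces. *)
Lemma invariants_not_serre n : ((3%:Z)%:E <= krull_dim R)%E -> (2 < n)%N ->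
  ~ serre n A.
Proof.
move=> /krull_dim_ge[P Pchain] n2 hS.
have [m mE] := invariant_max.
have contract i : exists q : prime_idealr A, forall a, (a \in q) = (val a \in P i).
  have [|q qE] := @prime_idealr_of A (fun a => val a \in P i).
    split; last by move=> a b; rewrite val_invariantM prime_idealrM => /orP.
      split; first by rewrite rmorph0 rpred0.
        by move=> a b aM bM; rewrite val_invariantD rpredD.
      by move=> a b bM; rewrite val_invariantM idealMr.
    by rewrite rmorph1 idealr1.
  by exists q => a; apply/idP/idP => /qE.
have [q qE] := choice contract.
have dim_m : ((3%:Z)%:E <= krull_dim (localization m))%E.
  apply/krull_dim_ge/localization_chain; exists q; split=> [i i3|i _ a].
    have [PP nPP] := Pchain i i3; split=> [a|H]; first by rewrite !qE => /PP.
    by apply: nPP; apply: (incomparability act_action PP) => a; rewrite -!qE => /H.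
  rewrite qE mE => aP; apply: contraT => aM.
  have [y Ey] := local_ring_unit R_noetherian R_local aM.
  by have := idealr1 (P i); rewrite -Ey mulrC idealMr.
have /depth_ge3[u [v [w [uM vM wM uv_reg w_reg]]]] :
    ((3%:Z)%:E <= depth (localization_max m))%E.
  by apply: le_trans (hS m); rewrite le_min dim_m lee_fin lez_nat n2.
have toA x := localization_invariant_max x mE.
have [a Eu] := toA u; have [b Ev] := toA v; have [c Ew] := toA w.
have abc : regular_triple a b c.
  split; first split.
  - move=> x ax; apply: (@tolocal_inj _ m); rewrite tolocal0.
    by apply: uv_reg.1; rewrite Eu -tolocalM ax tolocal0.
  - move=> x y E; have [|z' Ez] := uv_reg.2 (tolocal m x) (tolocal m y).
      by rewrite Eu Ev -!tolocalM E.
    have [z Ez'] := toA z'; exists z; apply: (@tolocal_inj _ m).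
    by rewrite Ez Ez' Eu tolocalM.
  - move=> x y z E.
    have [|y' [z' E']] := w_reg (tolocal m x) (tolocal m y) (tolocal m z).
      by rewrite Eu Ev Ew -!tolocalM -tolocalD E.
    have [y1 Ey] := toA y'; have [z1 Ez] := toA z'; exists y1, z1.
    by apply: (@tolocal_inj _ m); rewrite E' Ey Ez Eu Ev tolocalD !tolocalM.
rewrite {}Eu {}Ev {}Ew !tolocal_max !mE in uM vM wM.
have [i tra] := trace_invariant_radical uM.
have [j trb] := trace_invariant_radical vM.
have [k trc] := trace_invariant_radical wM.
apply: (no_regular_triple_of_traces tra trb trc).
exact/regular_triple_powl/regular_triple_powm/regular_triple_powr.
Qed.

End NotSerre3.

Theorem corollary1p6 (p r h : nat) (R : idomainType) (M : idealr R)
    (G : finGroupType) (act : G -> {rmorphism R -> R})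
    (R_char : p \in [pchar R]%R)
    (R_noetherian : noetherian R)
    (R_local : local_ring M)
    (act_action : ring_action act)
    (G_cyclic : cyclic [set: G])
    (G_card : #|G| = (p ^ r * h)%N)
    (r_gt0 : (0 < r)%N)
    (act_wild : acts_wildly act M) :
  (serre 2 R -> serre 2 (invariants act))
  /\ ((1%:E < depth M)%E -> (2%:E < krull_dim R)%E ->
      forall n : nat, (2 < n)%N -> ~ serre n (invariants act)).
Proof.
have A_noetherian : noetherian (invariants act) by case: act_wild.
split; first exact: invariants_serre2.
(* In the extended integers 1 < d is 2 <= d and 2 < d is 3 <= d. What remains is |G| = 0 in R: p
   divides |G| since r > 0. *)
move=> depth_M dim_R n; apply: (invariants_not_serre (M := M)) => //.
apply/eqP; rewrite -(dvdn_pcharf R_char) G_card -(prednK r_gt0) expnS.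
by rewrite -mulnA dvdn_mulr.
Qed.
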